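(* Let $L>0$, let $f:\mathbb{R}^d\to\mathbb{R}$ be an $L$-$\mathrm{QG}^+$ convex function, let $x_0\in\mathbb{R}^d$ and $n\in\mathbb{N}$. Let $x_0,x_1,\dots,x_n$ be generated by the subgradient method with constant step-size $\gamma=\frac1L$, i.e. $x_k=x_{k-1}-\frac1L g_{k-1}$ with $g_{k-1}\in\partial f(x_{k-1})$ arbitrary, for $k=1,\dots,n$. Then $$\frac{1}{n+1}\sum_{k=0}^n \bigl(f(x_k)-f_\star\bigr)\le \frac{L}{2}\,\frac{1}{n+1}\,d(x_0,\mathcal{X}_\star)^2 .$$
   Context: All functions $f:\mathbb{R}^d\to\mathbb{R}$ considered are assumed to have a non-empty set of global minimizers $\mathcal{X}_\star$; $f_\star=\min_{x} f(x)$; $d(x,\mathcal{X}_\star)=\min_{x_\star\in\mathcal{X}_\star}\|x-x_\star\|_2$. The function $f$ is $L$-quadratically upper bounded ($L$-$\mathrm{QG}^+$) if $f(x)-f_\star\le\frac L2 d(x,\mathcal{X}_\star)^2$ for all $x\in\mathbb{R}^d$. $\partial f(x)=\{g:\ f(y)\ge f(x)+\langle g,y-x\rangle\ \forall y\in\mathbb{R}^d\}$ is the subdifferential. *)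

(* Defs.v *)
From mathcomp Require Import all_boot all_order all_algebra.
From mathcomp Require Import all_classical all_reals all_analysis.

Set Implicit Arguments.
Unset Strict Implicit.
Unset Printing Implicit Defensive.

Import Order.TTheory GRing.Theory Num.Theory.

Local Open Scope classical_set_scope.
Local Open Scope ring_scope.

Definition dotp (R : realType) (d : nat) (u v : 'rV[R]_d) : R :=
  \sum_(i < d) u 0 i * v 0 i.

(* The library norm [`|u|] on ['rV[R]_d] is the sup norm, so the Euclidean
   norm has to be introduced separately. *)
Definition norm2 (R : realType) (d : nat) (u : 'rV[R]_d) : R :=
  Num.sqrt (dotp u u).

Definition minimizers (R : realType) (d : nat) (f : 'rV[R]_d -> R) :
    set 'rV[R]_d :=
  [set x | forall y, f x <= f y].

(* This is the minimum of [f] as soon as [minimizers f] is nonempty; otherwise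
   it may be a junk value. *)
Definition minval (R : realType) (d : nat) (f : 'rV[R]_d -> R) : R :=
  inf (range f).

(* Euclidean distance to a set.  The infimum is a minimum when [A] is nonempty
   and closed, in particular when [A] is the nonempty set of minimizers of a
   (real-valued, hence continuous) convex function; it is 0 when [A] is empty. *)
Definition dist2 (R : realType) (d : nat) (x : 'rV[R]_d) (A : set 'rV[R]_d) :
    R :=
  inf [set norm2 (x - y) | y in A].

(* L-QG+: L-quadratic upper bound. *)
Definition qg_plus (R : realType) (d : nat) (L : R) (f : 'rV[R]_d -> R) :
    Prop :=
  forall x, f x - minval f <= L / 2 * dist2 x (minimizers f) ^+ 2.

Definition subdifferential (R : realType) (d : nat) (f : 'rV[R]_d -> R)
    (x : 'rV[R]_d) : set 'rV[R]_d :=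
  [set g | forall y, f x + dotp g (y - x) <= f y].

(* Main.v *)
(* Testing the subgradient inequality at [z + L^-1 *: g], with [z] a minimizer,
   and bounding [f] there by QG+ improves the inequality at [z] by
   [|g|^2 / (2 L)].  This is exactly the term that makes
   [L / 2 * |x_k - z|^2] decrease by at least [f x_k - minval f] at each step;
   the sum telescopes, and the last term [f x_n - minval f] is absorbed by
   [L / 2 * |x_n - z|^2], again by QG+. *)
Require Import Defs.
From mathcomp Require Import all_boot all_order all_algebra.
From mathcomp Require Import ring lra.
From mathcomp Require Import all_classical all_reals all_analysis.

Set Implicit Arguments.
Unset Strict Implicit.
Unset Printing Implicit Defensive.

Import Order.TTheory GRing.Theory Num.Theory.

Local Open Scope classical_set_scope.
Local Open Scope ring_scope.

Section euclidean.
Variables (R : realType) (d : nat).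
Implicit Types (u v w : 'rV[R]_d) (a : R) (A : set 'rV[R]_d).

Lemma dotpC u v : dotp u v = dotp v u.
Proof. by apply: eq_bigr => i _; rewrite mulrC. Qed.

Lemma dotpDr u v w : dotp u (v + w) = dotp u v + dotp u w.
Proof. by rewrite -big_split; apply: eq_bigr => i _; rewrite mxE mulrDr. Qed.

Lemma dotpZr a u v : dotp u (a *: v) = a * dotp u v.
Proof. by rewrite mulr_sumr; apply: eq_bigr => i _; rewrite mxE mulrCA. Qed.

Lemma dotpNr u v : dotp u (- v) = - dotp u v.
Proof. by rewrite -scaleN1r dotpZr mulN1r. Qed.

Lemma dotp_ge0 u : 0 <= dotp u u.
Proof. by apply: sumr_ge0 => i _; rewrite -expr2 sqr_ge0. Qed.

Lemma norm2_ge0 u : 0 <= norm2 u.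
Proof. exact: sqrtr_ge0. Qed.

Lemma sqr_norm2 u : norm2 u ^+ 2 = dotp u u.
Proof. exact/sqr_sqrtr/dotp_ge0. Qed.

Lemma sqr_norm2B u v :
  norm2 (u - v) ^+ 2 = norm2 u ^+ 2 - 2 * dotp v u + norm2 v ^+ 2.
Proof.
rewrite !sqr_norm2 dotpDr dotpNr ![dotp (u - v) _]dotpC !dotpDr !dotpNr.
by rewrite [dotp u v]dotpC; ring.
Qed.

Lemma sqr_norm2Z a u : norm2 (a *: u) ^+ 2 = a ^+ 2 * norm2 u ^+ 2.
Proof. by rewrite !sqr_norm2 dotpZr dotpC dotpZr mulrA expr2. Qed.

Lemma dist2_ge0 u A : 0 <= dist2 u A.
Proof.
have [->|/set0P[z Az]] := eqVneq A set0; first by rewrite /dist2 image_set0 inf0.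
apply: lb_le_inf; first by exists (norm2 (u - z)), z.
by move=> _ [y _ <-]; exact: norm2_ge0.
Qed.

Lemma dist2_le u A z : A z -> dist2 u A <= norm2 (u - z).
Proof.
move=> Az; apply: ge_inf; last by exists z.
by exists 0 => _ [y _ <-]; exact: norm2_ge0.
Qed.

(** Taking square roots turns [a] into a lower bound of all the distances, hence of their infimum.
    Final bounds can thus be proved against each minimizer [z] separately, without choosing a
    nearest one. *)
Lemma le_sqr_dist2 a u A : A !=set0 ->
  (forall z, A z -> a <= norm2 (u - z) ^+ 2) -> a <= dist2 u A ^+ 2.
Proof.
(* For negative [a] the square root no longer squares back to [a], but a square is nonnegative
   anyway. *)
move=> [z0 Az0] aA; have [a_ge0|/ltW a_le0] := leP 0 a; last first.
  exact: le_trans a_le0 (sqr_ge0 _).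
rewrite -(sqr_sqrtr a_ge0) ler_pXn2r ?nnegrE ?sqrtr_ge0 ?dist2_ge0//.
apply: lb_le_inf; first by exists (norm2 (u - z0)), z0.
move=> _ [z Az <-]; rewrite -(ger0_norm (norm2_ge0 (u - z))) -sqrtr_sqr.
exact/ler_wsqrtr/aA.
Qed.

End euclidean.

Section qg_plus.
Variables (R : realType) (d : nat) (L : R) (f : 'rV[R]_d -> R).
Hypotheses (L_gt0 : 0 < L) (f_qg : qg_plus L f).

Lemma minvalE z : minimizers f z -> minval f = f z.
Proof.
move=> zf; apply/eqP; rewrite eq_le; apply/andP; split.
  by apply: ge_inf; [exists (f z) => _ [y _ <-]; exact: zf|exists z].
by apply: lb_le_inf; [exists (f z), z|move=> _ [y _ <-]; exact: zf].
Qed.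

Lemma qg_plus_le y z : minimizers f z ->
  f y - minval f <= L / 2 * norm2 (y - z) ^+ 2.
Proof.
move=> zf; apply: le_trans (f_qg y) _.
rewrite ler_pM2l ?divr_gt0// ler_pXn2r ?nnegrE ?dist2_ge0 ?norm2_ge0//.
exact: dist2_le.
Qed.

Lemma qg_plus_subdifferential_le y g z :
  minimizers f z -> subdifferential f y g ->
  f y - minval f + (2 * L)^-1 * norm2 g ^+ 2 <= dotp g (y - z).
Proof.
move=> zf /(_ (z + L^-1 *: g)); have := qg_plus_le (z + L^-1 *: g) zf.
rewrite [z + _]addrC addrK sqr_norm2Z -addrA !dotpDr !dotpNr dotpZr -sqr_norm2.
(* The displacement [L^-1 *: g] gains [L^-1 * norm2 g ^+ 2] in the subgradient inequality and costs
   half of that in QG+; the other half is the improvement. *)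
have -> : L / 2 * (L^-1 ^+ 2 * norm2 g ^+ 2) = (2 * L)^-1 * norm2 g ^+ 2.
  by field; rewrite gt_eqF.
have -> : L^-1 * norm2 g ^+ 2 = 2 * ((2 * L)^-1 * norm2 g ^+ 2).
  by field; rewrite gt_eqF.
by lra.
Qed.

Lemma subgradient_step_le y g z :
  minimizers f z -> subdifferential f y g ->
  f y - minval f + L / 2 * norm2 (y - L^-1 *: g - z) ^+ 2
    <= L / 2 * norm2 (y - z) ^+ 2.
Proof.
move=> zf /(qg_plus_subdifferential_le zf).
rewrite [y - _ - z]addrAC (sqr_norm2B (y - z)) sqr_norm2Z [dotp (L^-1 *: g) _]dotpC dotpZr.
rewrite [dotp _ g]dotpC.
set D := dotp _ _; set N := norm2 (y - z) ^+ 2; set M := norm2 g ^+ 2.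
(* With step size [L^-1] the cross term is exactly [D], and the quadratic term is exactly the
   improvement in the bound on [D]. *)
have -> : L / 2 * (N - 2 * (L^-1 * D) + L^-1 ^+ 2 * M)
    = L / 2 * N - D + (2 * L)^-1 * M by field; rewrite gt_eqF.
by lra.
Qed.

End qg_plus.

Theorem theorem2p1 (R : realType) (d : nat) (L : R) (f : 'rV[R]_d -> R)
    (n : nat) (x g : nat -> 'rV[R]_d)
    (L_gt0 : 0 < L)
    (minimizers_neq0 : minimizers f !=set0)
    (f_convex : convex_function [set: 'rV[R]_d] f)
    (f_qg : qg_plus L f)
    (g_subgrad : forall k, (1 <= k <= n)%N ->
      subdifferential f (x k.-1) (g k.-1))
    (x_step : forall k, (1 <= k <= n)%N ->
      x k = x k.-1 - L^-1 *: g k.-1) :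
  (n.+1%:R)^-1 * (\sum_(0 <= k < n.+1) (f (x k) - minval f))
    <= L / 2 * (n.+1%:R)^-1 * dist2 (x 0%N) (minimizers f) ^+ 2.
Proof.
set X := minimizers f; set m := minval f.
suff sum_le : \sum_(0 <= k < n.+1) (f (x k) - m)
    <= L / 2 * dist2 (x 0%N) X ^+ 2.
  by rewrite mulrAC mulrC ler_pM2r// invr_gt0 ltr0n.
rewrite -ler_pdivrMl ?divr_gt0//; apply: le_sqr_dist2 => // z Xz.
rewrite ler_pdivrMl ?divr_gt0//.
(* The sum stops before [k]: only [n] steps are available for [n.+1] terms, so the term at [n] is
   left for QG+ at [x n]. *)
have telescope k : (k <= n)%N ->
    \sum_(0 <= i < k) (f (x i) - m) + L / 2 * norm2 (x k - z) ^+ 2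
    <= L / 2 * norm2 (x 0%N - z) ^+ 2.
  elim: k => [|k IHk] lt_kn; first by rewrite big_nil add0r.
  apply: le_trans (IHk (ltnW lt_kn)).
  rewrite big_nat_recr//= -addrA lerD2l (x_step k.+1 lt_kn)/=.
  exact: (subgradient_step_le L_gt0 f_qg Xz (g_subgrad k.+1 lt_kn)).
apply: le_trans (telescope n (leqnn n)).
by rewrite big_nat_recr//= lerD2l; exact: qg_plus_le.
Qed.
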